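(* For every set $M$ there exists a metrically free (i.e. $\odot$-free) matricially normed space with base $M$, and it is the matricial $\ell_1$-sum of the family of copies of the matricially normed space $\widehat M_\infty$ indexed by the points of $M$. Thus, the rigged category $(\mathbf{MN_1},\odot)$ admits freeness.
   Context: All linear spaces are complex. $M_n$ is the linear space of $n\times n$ complex matrices, $\|\cdot\|_o$ the operator norm on it. For a linear space $E$, $M_n(E)$ is the space of $n\times n$ matrices with entries in $E$ (identified with $M_n\otimes E$); $u\oplus w$ denotes the block-diagonal matrix with blocks $u,w$. The closed unit ball of a normed space $X$ is $B_X$. A matrix-norm on $E$ is a sequence of norms $\|\cdot\|_n$ on $M_n(E)$, $n\in\mathbb N$, such that (Axiom 1) $\|u\oplus 0\|_{n+m}=\|u\|_n$ for $u\in M_n(E)$ and $0\in M_m(E)$; (Axiom 2) $\|Su\|_n\le\|S\|_o\|u\|_n$ and $\|uS\|_n\le\|u\|_n\|S\|_o$ for $u\in M_n(E)$, $S\in M_n$. A matricially normed space is a linear space with a matrix-norm. For a linear operator $\varphi:E\to F$, its $m$-th amplification is $\varphi_m:M_m(E)\to M_m(F)$, $(x_{ij})\mapsto(\varphi(x_{ij}))$. Between matricially normed spaces, $\varphi$ is completely contractive if every $\varphi_m$ is contractive. $\mathbf{MN_1}$ is the category of matricially normed spaces and completely contractive operators. The space $\widehat M_n$: for a linear space $E$ and $v=(x_{ij})\in M_n(E)$ let $\varphi^v:M_n\to E$, $(\lambda_{ij})\mapsto\sum_{i,j}\lambda_{ji}x_{ij}$. $\widehat M_n$ is $M_n$ with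 the matrix-norm given on $u\in M_m(M_n)$ by $\|u\|_m:=\sup\|(\varphi^v)_m(u)\|_m$, the supremum taken over all pairs $(E,v)$ with $E$ a matricially normed space and $v\in B_{M_n(E)}$. Matricial $\ell_1$-sum of a family $E_\nu$, $\nu\in\Lambda$, of matricially normed spaces: the algebraic direct sum $E=\bigoplus_\nu E_\nu$ where, for each $m$, $M_m(E)$ is identified with $\bigoplus_\nu M_m(E_\nu)$ and given the $\ell_1$-sum norm $\|(u_\nu)\|=\sum_\nu\|u_\nu\|_m$ (no completion is taken). $\widehat M_\infty$ is the matricial $\ell_1$-sum of the family $\{\widehat M_n:n\in\mathbb N\}$. A rig of a category $\mathcal K$ is a faithful covariant functor $\square:\mathcal K\to\mathcal L$ to another category; $(\mathcal K,\square)$ is then a rigged category. For an object $M$ of $\mathcal L$, an object $\mathbf{Fr}(M)$ of $\mathcal K$ is $\square$-free with base $M$ if for every object $X$ of $\mathcal K$ there is a bijection, natural in $X$, from the set of $\mathcal L$-morphisms $M\to\square X$ onto the set of $\mathcal K$-morphisms $\mathbf{Fr}(M)\to X$. The rigged category admits freeness if every object of $\mathcal L$ is a base of a free object in $\mathcal K$. The rig $\odot:\mathbf{MN_1}\to\mathbf{Set}$ takes $E$ to the cartesian product $\prod_{m=1}^\infty B_{M_m(E)}$ and a morphism $\varphi:E\to F$ to the map $(w_1,\dots,w_m,\dots)\mapsto(\varphi_1(w_1),\dots,\varphi_m(w_m),\dots)$. ''Metrically free'' means $\odot$-free. *)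

(* Defs.v *)
From HB Require Import structures.
From mathcomp Require Import all_boot all_order all_algebra.
From mathcomp Require Import all_classical all_reals.
From mathcomp Require Import finmap complex ring.

Set Implicit Arguments.
Unset Strict Implicit.
Unset Printing Implicit Defensive.

Import Order.TTheory GRing.Theory Num.Theory.
Import ComplexField.Normc.

Local Open Scope classical_set_scope.
Local Open Scope ring_scope.

Record category := Category {
  obj :> Type;
  hom : obj -> obj -> Type;
  idm : forall X, hom X X;
  comp : forall X Y Z, hom Y Z -> hom X Y -> hom X Z;
  comp_idl : forall X Y (f : hom X Y), comp (idm Y) f = f;
  comp_idr : forall X Y (f : hom X Y), comp f (idm X) = f;
  compA : forall X Y Z T (h : hom Z T) (g : hom Y Z) (f : hom X Y),
    comp h (comp g f) = comp (comp h g) f }.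

Arguments hom {c}.
Arguments idm {c}.
Arguments comp {c X Y Z}.

Record functor (K L : category) := Functor {
  fobj :> K -> L;
  fmap : forall X Y, hom X Y -> hom (fobj X) (fobj Y);
  fmap_id : forall X, fmap (idm X) = idm (fobj X);
  fmap_comp : forall X Y Z (g : hom Y Z) (f : hom X Y),
    fmap (comp g f) = comp (fmap g) (fmap f) }.

Arguments fmap {K L} _ {X Y}.

Record rig (K L : category) := Rig {
  rig_functor :> functor K L;
  rig_faithful : forall X Y, injective (@fmap K L rig_functor X Y) }.

Definition is_free (K L : category) (sq : rig K L) (M : L) (F : K) : Prop :=
  exists beta : forall X : K, hom M (sq X) -> hom F X,
    (forall X, bijective (beta X)) /\
    (forall (X Y : K) (h : hom X Y) (f : hom M (sq X)),
        beta Y (comp (fmap sq h) f) = comp h (beta X f)).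

Definition admits_freeness (K L : category) (sq : rig K L) : Prop :=
  forall M : L, exists F : K, is_free sq M F.

Definition SET : category :=
  @Category Type (fun X Y => X -> Y) (fun _ => id)
    (fun X Y Z g f => g \o f)
    (fun _ _ _ => erefl) (fun _ _ _ => erefl) (fun _ _ _ _ _ _ _ => erefl).

Section OperatorNorm.
Variable R : realType.
Local Notation C := R[i].

Definition l2norm n (x : 'cV[C]_n) : R :=
  Num.sqrt (\sum_i normc (x i 0) ^+ 2).

Definition opnorm n (S : 'M[C]_n) : R :=
  sup [set l2norm (S *m x) | x in [set x : 'cV[C]_n | l2norm x <= 1]].

Lemma normc_ge0 (a : C) : 0 <= normc a.
Proof. by case: a => a b; rewrite sqrtr_ge0. Qed.

Lemma normc_sum (I : Type) (r : seq I) (P : pred I) (F : I -> C) :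
  normc (\sum_(i <- r | P i) F i) <= \sum_(i <- r | P i) normc (F i).
Proof.
elim/big_rec2: _ => [|i y x _ le]; first by rewrite normc0.
by apply: le_trans (le_normcD _ _) _; rewrite lerD2l.
Qed.

Lemma l2norm_ge0 n (x : 'cV[C]_n) : 0 <= l2norm x.
Proof. exact: sqrtr_ge0. Qed.

Lemma sqr_l2norm n (x : 'cV[C]_n) :
  l2norm x ^+ 2 = \sum_i normc (x i 0) ^+ 2.
Proof. by rewrite sqr_sqrtr// sumr_ge0// => i _; rewrite sqr_ge0. Qed.

Lemma l2norm_ge n (x : 'cV[C]_n) i : normc (x i 0) <= l2norm x.
Proof.
rewrite -(@ler_pXn2r _ 2) ?nnegrE ?normc_ge0 ?l2norm_ge0//.
rewrite sqr_l2norm (bigD1 i)//= lerDl sumr_ge0// => j _; exact: sqr_ge0.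
Qed.

Lemma l2norm_eq0 n (x : 'cV[C]_n) : l2norm x = 0 -> x = 0.
Proof.
move=> x0; apply/matrixP => i j; rewrite (ord1 j) mxE; apply: eq0_normc.
by apply: le_anti; rewrite normc_ge0 -x0 l2norm_ge.
Qed.

Lemma l2normZ n a (x : 'cV[C]_n) : l2norm (a *: x) = normc a * l2norm x.
Proof.
apply: (@pexpIrn _ 2) => //; rewrite ?nnegrE ?mulr_ge0 ?normc_ge0 ?l2norm_ge0//.
rewrite exprMn !sqr_l2norm mulr_sumr; apply: eq_bigr => i _.
by rewrite mxE normcM exprMn.
Qed.

Lemma l2norm0 n : l2norm (0 : 'cV[C]_n) = 0.
Proof. by rewrite -(scale0r 0) l2normZ normc0 mul0r. Qed.

Lemma cauchy_schwarz n (a b : 'I_n -> R) :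
  (\sum_i a i * b i) ^+ 2 <= (\sum_i a i ^+ 2) * (\sum_i b i ^+ 2).
Proof.
set A := \sum_i a i ^+ 2; set B := \sum_i b i ^+ 2; set D := \sum_i _.
have A0 : 0 <= A by apply: sumr_ge0 => i _; exact: sqr_ge0.
have key t : 0 <= A * t ^+ 2 + (2 * D) * t + B.
  have -> : A * t ^+ 2 + 2 * D * t + B = \sum_i (a i * t + b i) ^+ 2.
    rewrite mulr_suml [2 * D]mulr_sumr mulr_suml -!big_split/=.
    by apply: eq_bigr => i _; ring.
  by apply: sumr_ge0 => i _; exact: sqr_ge0.
have [A00|An0] := eqVneq A 0.
  rewrite A00 mul0r le_eqVlt; apply/orP; left; rewrite sqrf_eq0 /D big1// => i _.
  suff -> : a i = 0 by rewrite mul0r.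
  move/eqP: A00; rewrite psumr_eq0 => [|j _]; last exact: sqr_ge0.
  by move=> /allP/(_ i (mem_index_enum _)); rewrite /= sqrf_eq0 => /eqP.
have := key (- (D / A)); have Ap : 0 < A by rewrite lt_neqAle eq_sym An0.
suff -> : A * (- (D / A)) ^+ 2 + 2 * D * - (D / A) + B = B - D ^+ 2 / A.
  by rewrite subr_ge0 ler_pdivrMr// mulrC.
by field.
Qed.

Lemma l2normD n (x y : 'cV[C]_n) : l2norm (x + y) <= l2norm x + l2norm y.
Proof.
rewrite -(@ler_pXn2r _ 2) ?nnegrE ?addr_ge0 ?l2norm_ge0//.
rewrite sqrrD !sqr_l2norm.
have le1 : \sum_i normc ((x + y) i 0) ^+ 2 <=
    \sum_i (normc (x i 0) + normc (y i 0)) ^+ 2.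
  apply: ler_sum => i _; rewrite mxE ler_pXn2r ?nnegrE ?addr_ge0 ?normc_ge0//.
  exact: le_normcD.
apply: le_trans le1 _.
have -> : \sum_i (normc (x i 0) + normc (y i 0)) ^+ 2 =
    \sum_i normc (x i 0) ^+ 2 + (\sum_i normc (x i 0) * normc (y i 0)) *+ 2 +
    \sum_i normc (y i 0) ^+ 2.
  by rewrite -sumrMnl -!big_split/=; apply: eq_bigr => i _; rewrite sqrrD.
rewrite lerD2r lerD2l lerMn2r/=.
apply: le_trans (ler_norm _) _.
rewrite -(@ler_pXn2r _ 2) ?nnegrE ?mulr_ge0 ?l2norm_ge0//.
rewrite real_normK ?num_real// exprMn !sqr_l2norm; exact: cauchy_schwarz.
Qed.

Lemma l2norm_le_sum n (x : 'cV[C]_n) : l2norm x <= \sum_i normc (x i 0).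
Proof.
have s0 : 0 <= \sum_i normc (x i 0) by apply: sumr_ge0 => i _; exact: normc_ge0.
rewrite -(@ler_pXn2r _ 2) ?nnegrE ?l2norm_ge0// sqr_l2norm expr2 mulr_suml.
apply: ler_sum => i _; rewrite expr2 ler_wpM2l ?normc_ge0// (bigD1 i)//= lerDl.
by apply: sumr_ge0 => j _; exact: normc_ge0.
Qed.

Lemma has_sup_opnorm n (S : 'M[C]_n) :
  has_sup [set l2norm (S *m x) | x in [set x : 'cV[C]_n | l2norm x <= 1]].
Proof.
split; first by exists (l2norm (S *m 0)), 0 => //=; rewrite l2norm0.
exists (\sum_i \sum_j normc (S i j)) => _ [x /= x1 <-].
apply: le_trans (l2norm_le_sum _) _; apply: ler_sum => i _; rewrite mxE.
apply: le_trans (normc_sum _ _ _) _; apply: ler_sum => j _; rewrite normcM.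
by rewrite ler_piMr ?normc_ge0// (le_trans (l2norm_ge x j)).
Qed.

Lemma l2norm_le_opnorm n (S : 'M[C]_n) x :
  l2norm (S *m x) <= opnorm S * l2norm x.
Proof.
have [x0|xn0] := eqVneq (l2norm x) 0.
  by rewrite (l2norm_eq0 x0) mulmx0 l2norm0 mulr0.
have xp : 0 < l2norm x by rewrite lt_neqAle eq_sym xn0 l2norm_ge0.
pose a : C := ((l2norm x)^-1)%:C%C.
have na : normc a = (l2norm x)^-1.
  by rewrite /= expr0n/= addr0 sqrtr_sqr ger0_norm// invr_ge0 ltW.
rewrite -ler_pdivrMr// mulrC -na -l2normZ scalemxAr.
apply: sup_upper_bound; first exact: has_sup_opnorm.
by exists (a *: x) => //=; rewrite l2normZ na mulVf.
Qed.

Lemma opnorm_le n (S : 'M[C]_n) c :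
  (forall x, l2norm x <= 1 -> l2norm (S *m x) <= c) -> opnorm S <= c.
Proof.
move=> Sc; apply: ge_sup; first by have [] := has_sup_opnorm S.
by move=> _ [x /= /Sc ? <-].
Qed.

Lemma opnorm_ge0 n (S : 'M[C]_n) : 0 <= opnorm S.
Proof.
apply: (le_trans (l2norm_ge0 (S *m 0))).
by apply: sup_upper_bound; [exact: has_sup_opnorm|exists 0 => //=; rewrite l2norm0].
Qed.

Lemma opnormD n (S T : 'M[C]_n) : opnorm (S + T) <= opnorm S + opnorm T.
Proof.
apply: opnorm_le => x x1; rewrite mulmxDl (le_trans (l2normD _ _))//.
by rewrite lerD// (le_trans (l2norm_le_opnorm _ _))// ler_piMr ?opnorm_ge0.
Qed.

Lemma opnormM n (S T : 'M[C]_n) : opnorm (S *m T) <= opnorm S * opnorm T.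
Proof.
apply: opnorm_le => x x1; rewrite -mulmxA (le_trans (l2norm_le_opnorm _ _))//.
rewrite ler_wpM2l ?opnorm_ge0// (le_trans (l2norm_le_opnorm _ _))//.
by rewrite ler_piMr ?opnorm_ge0.
Qed.

Lemma opnormZ_le n a (S : 'M[C]_n) : opnorm (a *: S) <= normc a * opnorm S.
Proof.
apply: opnorm_le => x x1; rewrite -scalemxAl l2normZ ler_wpM2l ?normc_ge0//.
by rewrite (le_trans (l2norm_le_opnorm _ _))// ler_piMr ?opnorm_ge0.
Qed.

Lemma opnorm_eq0 n (S : 'M[C]_n) : opnorm S = 0 -> S = 0.
Proof.
move=> S0; apply/matrixP => i j.
have /l2norm_eq0 : l2norm (S *m delta_mx j 0) = 0.
  apply: le_anti; rewrite l2norm_ge0 andbT.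
  by rewrite (le_trans (l2norm_le_opnorm _ _))// S0 mul0r.
by rewrite -colE => /matrixP/(_ i 0); rewrite !mxE.
Qed.

Lemma opnorm_delta n (i j : 'I_n) : opnorm (delta_mx i j) <= 1.
Proof.
apply: opnorm_le => x x1.
have -> : delta_mx i j *m x = x j 0 *: delta_mx i 0.
  apply/matrixP => k l; rewrite (ord1 l) !mxE (bigD1 j)//= big1 => [|m jm].
    by rewrite !mxE !eqxx !andbT addr0 mulrC.
  by rewrite mxE (negPf jm) andbF mul0r.
rewrite l2normZ; have -> : l2norm (delta_mx i 0 : 'cV[C]_n) = 1.
  rewrite /l2norm (bigD1 i)//= big1 => [|k ki].
    by rewrite mxE !eqxx normc1 expr1n addr0 sqrtr1.
  by rewrite mxE (negPf ki) normc0 expr0n.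
by rewrite mulr1 (le_trans (l2norm_ge x j)).
Qed.

End OperatorNorm.

Section MatriciallyNormed.
Variable R : realType.
Local Notation C := R[i].

Definition lact (E : lmodType C) n (S : 'M[C]_n) (u : 'M[E]_n) : 'M[E]_n :=
  \matrix_(i, j) \sum_k S i k *: u k j.

Definition ract (E : lmodType C) n (u : 'M[E]_n) (S : 'M[C]_n) : 'M[E]_n :=
  \matrix_(i, j) \sum_k S k j *: u i k.

(* u (+) 0, with 0 in M_m(E); it is typed so that its size is a visible
   successor. *)
Definition dsum0 (E : lmodType C) n m (u : 'M[E]_n.+1) : 'M[E]_((n + m).+1) :=
  @block_mx E n.+1 m n.+1 m u 0 0 0.

Lemma map_dsum0 (E F : lmodType C) (f : {linear E -> F}) n m (u : 'M[E]_n.+1) :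
  map_mx f (dsum0 m u) = dsum0 m (map_mx f u).
Proof.
have := map_block_mx f u (0 : 'M_(n.+1, m)) (0 : 'M_(m, n.+1)) (0 : 'M_m).
by rewrite !map_mx0.
Qed.

(* Sizes of matrices range over n >= 1, so that M_n(E) is 'M[E]_k.+1 with
   n = k.+1, and N k is the norm on M_{k+1}(E). *)
Record is_matrix_norm (E : lmodType C) (N : forall n, 'M[E]_n.+1 -> R) : Prop :=
  IsMatrixNorm {
    mxnormD : forall n (u w : 'M[E]_n.+1), N n (u + w) <= N n u + N n w;
    mxnormZ : forall n (a : C) (u : 'M[E]_n.+1),
      N n (map_mx ( *:%R a) u) = normc a * N n u;
    mxnorm_eq0 : forall n (u : 'M[E]_n.+1), N n u = 0 -> u = 0;
    mxnorm_dsum0 : forall n m (u : 'M[E]_n.+1),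
      N (n + m)%N (dsum0 m u) = N n u;
    mxnorm_lact : forall n (S : 'M[C]_n.+1) (u : 'M[E]_n.+1),
      N n (lact S u) <= opnorm S * N n u;
    mxnorm_ract : forall n (S : 'M[C]_n.+1) (u : 'M[E]_n.+1),
      N n (ract u S) <= N n u * opnorm S }.

Record mnSpace := MNSpace {
  mn_sort :> lmodType C;
  mnorm : forall n, 'M[mn_sort]_n.+1 -> R;
  mnormP : is_matrix_norm mnorm }.

Arguments mnorm {_ n}.

Section Theory.
Variable E : mnSpace.

Lemma mnormD n (u w : 'M[E]_n.+1) : mnorm (u + w) <= mnorm u + mnorm w.
Proof. exact: (mxnormD (mnormP E)). Qed.

Lemma mnormZ n a (u : 'M[E]_n.+1) :
  mnorm (map_mx ( *:%R a) u) = normc a * mnorm u.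
Proof. exact: (mxnormZ (mnormP E)). Qed.

Lemma mnorm_eq0 n (u : 'M[E]_n.+1) : mnorm u = 0 -> u = 0.
Proof. exact: (mxnorm_eq0 (mnormP E)). Qed.

Lemma mnorm_dsum0 n m (u : 'M[E]_n.+1) : mnorm (dsum0 m u) = mnorm u.
Proof. exact: (mxnorm_dsum0 (mnormP E)). Qed.

Lemma mnorm_lact n (S : 'M[C]_n.+1) (u : 'M[E]_n.+1) :
  mnorm (lact S u) <= opnorm S * mnorm u.
Proof. exact: (mxnorm_lact (mnormP E)). Qed.

Lemma mnorm_ract n (S : 'M[C]_n.+1) (u : 'M[E]_n.+1) :
  mnorm (ract u S) <= mnorm u * opnorm S.
Proof. exact: (mxnorm_ract (mnormP E)). Qed.

Lemma mnorm0 n : mnorm (0 : 'M[E]_n.+1) = 0.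
Proof.
have -> : (0 : 'M[E]_n.+1) = map_mx ( *:%R (0 : C)) 0.
  by apply/matrixP => i j; rewrite !mxE scale0r.
by rewrite mnormZ normc0 mul0r.
Qed.

Lemma mnorm_ge0 n (u : 'M[E]_n.+1) : 0 <= mnorm u.
Proof.
have Nu : mnorm (- u) = mnorm u.
  have -> : - u = map_mx ( *:%R (-1 : C)) u.
    by apply/matrixP => i j; rewrite !mxE scaleN1r.
  by rewrite mnormZ normcN normc1 mul1r.
by have := mnormD u (- u); rewrite subrr mnorm0 Nu -mulr2n pmulrn_lge0.
Qed.

Lemma mnorm_sum n (I : Type) (r : seq I) (P : pred I) (F : I -> 'M[E]_n.+1) :
  mnorm (\sum_(i <- r | P i) F i) <= \sum_(i <- r | P i) mnorm (F i).
Proof.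
elim/big_rec2: _ => [|i y x _ le]; first by rewrite mnorm0.
by apply: le_trans (mnormD _ _) _; rewrite lerD2l.
Qed.

Definition single_mx n (i j : 'I_n) (x : E) : 'M[E]_n :=
  \matrix_(k, l) (if (k == i) && (l == j) then x else 0).

Lemma mx_sum_single n (u : 'M[E]_n) :
  u = \sum_i \sum_j single_mx i j (u i j).
Proof.
apply/matrixP => k l; rewrite summxE (bigD1 k)//= summxE (bigD1 l)//=.
rewrite mxE !eqxx/= big1 ?addr0 => [|j jl]; last first.
  by rewrite mxE eqxx/= eq_sym (negPf jl).
rewrite big1 ?addr0// => i ik; rewrite summxE big1// => j _.
by rewrite mxE eq_sym (negPf ik).
Qed.

Lemma lact_delta n (i j : 'I_n) (u : 'M[E]_n) :
  lact (delta_mx i j) u = \matrix_(k, l) (if k == i then u j l else 0).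
Proof.
apply/matrixP => k l; rewrite !mxE (bigD1 j)//= big1 => [|m mj]; rewrite !mxE.
  by rewrite eqxx andbT addr0; case: eqP => _; rewrite ?scale1r ?scale0r.
by rewrite (negPf mj) andbF scale0r.
Qed.

Lemma ract_delta n (i j : 'I_n) (u : 'M[E]_n) :
  ract u (delta_mx i j) = \matrix_(k, l) (if l == j then u k i else 0).
Proof.
apply/matrixP => k l; rewrite !mxE (bigD1 i)//= big1 => [|m mj]; rewrite !mxE.
  by rewrite eqxx addr0/=; case: eqP => _; rewrite ?scale1r ?scale0r.
by rewrite (negPf mj) scale0r.
Qed.

Lemma mnorm_delta n (i i' j j' : 'I_n.+1) (u : 'M[E]_n.+1) :
  mnorm (ract (lact (delta_mx i i') u) (delta_mx j' j)) <= mnorm u.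
Proof.
apply: le_trans (mnorm_ract _ _) _.
apply: le_trans (_ : _ <= mnorm (lact (delta_mx i i') u)) _.
  by rewrite ler_piMr ?mnorm_ge0// opnorm_delta.
by rewrite (le_trans (mnorm_lact _ _))// ler_piMl ?mnorm_ge0// opnorm_delta.
Qed.

Lemma single_mxE n (i i' j j' : 'I_n) (u : 'M[E]_n) :
  single_mx i j (u i' j') = ract (lact (delta_mx i i') u) (delta_mx j' j).
Proof.
rewrite lact_delta ract_delta; apply/matrixP => k l; rewrite !mxE.
by case: (k == i); case: (l == j).
Qed.

Lemma mnorm_single n (i j : 'I_n.+1) (x : E) :
  mnorm (single_mx i j x) = mnorm (const_mx x : 'M[E]_1).
Proof.
have e0 : dsum0 n (const_mx x : 'M[E]_1) = single_mx (ord0 : 'I_n.+1) ord0 x.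
  apply/matrixP => k l; rewrite /dsum0 !mxE.
  have lk (k' : 'I_(1 + n)) : (nat_of_ord k' == 0%N) =
      (if fintype.split k' is inl _ then true else false).
    by case: splitP => k'' e; rewrite e ?(ord1 k'').
  have kE := lk k; have lE := lk l.
  rewrite -!val_eqE/= kE lE; case: (fintype.split _) => k'; rewrite !mxE;
  by case: (fintype.split _) => l'; rewrite ?mxE.
have -> : mnorm (const_mx x : 'M[E]_1) = mnorm (single_mx (ord0 : 'I_n.+1) ord0 x).
  by rewrite -e0; exact: esym (mnorm_dsum0 _ _).
have le (k k' l l' : 'I_n.+1) : mnorm (single_mx k l x) <= mnorm (single_mx k' l' x).
  have -> : single_mx k l x = single_mx k l (single_mx k' l' x k' l').
    by rewrite [in RHS]mxE !eqxx.
  by rewrite (single_mxE k k' l l'); exact: mnorm_delta.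
by apply: le_anti; rewrite !le.
Qed.

Lemma mnorm_entry n (i j : 'I_n.+1) (u : 'M[E]_n.+1) :
  mnorm (const_mx (u i j) : 'M[E]_1) <= mnorm u.
Proof. by rewrite -(mnorm_single i j) single_mxE mnorm_delta. Qed.

Lemma mnorm_le_sum n (u : 'M[E]_n.+1) :
  mnorm u <= \sum_i \sum_j mnorm (const_mx (u i j) : 'M[E]_1).
Proof.
rewrite {1}(mx_sum_single u); apply: le_trans (mnorm_sum _ _ _) _.
apply: ler_sum => i _; apply: le_trans (mnorm_sum _ _ _) _.
by apply: ler_sum => j _; rewrite mnorm_single.
Qed.

End Theory.

Definition completely_contractive (E F : mnSpace) (f : E -> F) : Prop :=
  forall n (u : 'M[E]_n.+1), mnorm (map_mx f u) <= mnorm u.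

Record mnHom (E F : mnSpace) := MNHom {
  mn_fun :> E -> F;
  mn_linear : linear mn_fun;
  mn_cc : completely_contractive mn_fun }.

Lemma mnHom_eq (E F : mnSpace) (f g : mnHom E F) : f =1 g -> f = g.
Proof.
case: f g => f lf cf [g lg cg] /= /funext fg; subst g.
by congr MNHom; exact: Prop_irrelevance.
Qed.

Section Identity.
Variable E : mnSpace.

Lemma mn_id_linear : linear (@id E).
Proof. by []. Qed.

Lemma mn_id_cc : completely_contractive (@id E).
Proof. by move=> n u; rewrite map_mx_id. Qed.

Definition mn_id : mnHom E E := MNHom mn_id_linear mn_id_cc.
End Identity.

Section Composition.
Variables (E F G : mnSpace) (g : mnHom F G) (f : mnHom E F).

Lemma mn_comp_linear : linear (g \o f).
Proof. by move=> a x y /=; rewrite !mn_linear. Qed.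

Lemma mn_comp_cc : completely_contractive (g \o f).
Proof.
move=> n u; rewrite map_mx_comp.
exact: le_trans (mn_cc g _) (mn_cc f _).
Qed.

Definition mn_comp : mnHom E G := MNHom mn_comp_linear mn_comp_cc.
End Composition.

Lemma mn_idl (E F : mnSpace) (f : mnHom E F) : mn_comp (mn_id F) f = f.
Proof. exact: mnHom_eq. Qed.

Lemma mn_idr (E F : mnSpace) (f : mnHom E F) : mn_comp f (mn_id E) = f.
Proof. exact: mnHom_eq. Qed.

Lemma mn_compA (E F G H : mnSpace) (h : mnHom G H) (g : mnHom F G)
    (f : mnHom E F) : mn_comp h (mn_comp g f) = mn_comp (mn_comp h g) f.
Proof. exact: mnHom_eq. Qed.

Definition MN1 : category := Category mn_idl mn_idr mn_compA.

Definition mxball (E : mnSpace) n : Type := {w : 'M[E]_n.+1 | mnorm w <= 1}.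

Definition mxball_map (E F : mnSpace) (f : mnHom E F) n (w : mxball E n) :
    mxball F n :=
  exist _ (map_mx f (sval w)) (le_trans (mn_cc f (sval w)) (svalP w)).

(* Component n is the unit ball of M_{n+1}(E). *)
Definition odot_obj (E : MN1) : SET := forall n, mxball E n.

Definition odot_map (E F : MN1) (f : hom E F) :
    hom (odot_obj E) (odot_obj F) :=
  fun w n => mxball_map f (w n).

Lemma odot_id (E : MN1) : @odot_map E E (idm E) = idm (odot_obj E).
Proof.
apply/funext => w; apply/functional_extensionality_dep => n.
by apply/val_inj; rewrite /= map_mx_id.
Qed.

Lemma odot_comp (E F G : MN1) (g : hom F G) (f : hom E F) :
  odot_map (comp g f) = comp (odot_map g) (odot_map f).
Proof.
apply/funext => w; apply/functional_extensionality_dep => n.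
by apply/val_inj; rewrite /= map_mx_comp.
Qed.

Definition odot_functor : functor MN1 SET := Functor odot_id odot_comp.

Lemma odot_faithful (E F : MN1) : injective (@fmap _ _ odot_functor E F).
Proof.
move=> f g fg; apply: mnHom_eq => x.
pose r : R := (mnorm (const_mx x : 'M[E]_1) + 1)^-1.
have r0 : 0 < r by rewrite invr_gt0 ltr_wpDl ?mnorm_ge0.
have nr : normc (r%:C)%C = r.
  by rewrite /= expr0n/= addr0 sqrtr_sqr ger0_norm// ltW.
pose w (n : nat) : 'M[E]_n.+1 := single_mx ord0 ord0 ((r%:C)%C *: x).
have wle n : mnorm (w n) <= 1.
  rewrite /w mnorm_single.
  have -> : const_mx ((r%:C)%C *: x) = map_mx ( *:%R (r%:C)%C) (const_mx x : 'M[E]_1).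
    by apply/matrixP => i j; rewrite !mxE.
  by rewrite mnormZ nr mulrC ler_pdivrMr ?mul1r ?lerDl// -invr_gt0.
pose ww : odot_obj E := fun n => exist _ (w n) (wle n).
have efg : odot_map f = odot_map g := fg.
have : sval (odot_map f ww 0%N) ord0 ord0 = sval (odot_map g ww 0%N) ord0 ord0.
  by rewrite efg.
rewrite /= !mxE/=.
have lz (h : hom E F) a y : (h : mnHom E F) (a *: y) = a *: (h : mnHom E F) y.
  have h0 : (h : mnHom E F) 0 = 0.
    have := mn_linear h 1 0 0; rewrite scale1r addr0 scale1r => e.
    by apply: (addrI ((h : mnHom E F) 0)); rewrite addr0 -e.
  by have := mn_linear h a y 0; rewrite addr0 h0 addr0.
rewrite !lz => /(congr1 ( *:%R ((r%:C)%C^-1))).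
rewrite !scalerA mulVf ?scale1r//.
by apply/eqP => /(congr1 (@normc R)); rewrite nr normc0 => e; rewrite e ltxx in r0.
Qed.

Definition odot : rig MN1 SET := Rig odot_faithful.

Section Hat.
Variable k : nat.

Definition phi (E : lmodType C) n (v : 'M[E]_n) (l : 'M[C]_n) : E :=
  \sum_i \sum_j l j i *: v i j.

Lemma phi_linear (E : lmodType C) n (v : 'M[E]_n) : linear (phi v).
Proof.
move=> a l m; rewrite /phi scaler_sumr -big_split/=; apply: eq_bigr => i _.
rewrite scaler_sumr -big_split/=; apply: eq_bigr => j _.
by rewrite !mxE scalerDl scalerA.
Qed.

HB.instance Definition _ (E : lmodType C) n (v : 'M[E]_n) :=
  GRing.isLinear.Build C 'M[C]_n E _ (phi v) (phi_linear v).

Definition hat_values n (u : 'M['M[C]_k.+1]_n.+1) : set R :=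
  [set r | exists (E : mnSpace) (v : 'M[E]_k.+1),
     mnorm v <= 1 /\ r = mnorm (map_mx (phi v) u)].

Definition hat_norm n (u : 'M['M[C]_k.+1]_n.+1) : R := sup (hat_values u).

(* The complex field with operator norms on its matrices is a matricially
   normed space; it separates the points of M_n, so that hat_norm is a norm
   and not only a seminorm. *)
Lemma opnorm_matrix_norm : @is_matrix_norm (C^o) (fun n => @opnorm R n.+1).
Proof.
split => [n u w|n a u|n u|n m u|n S u|n S u].
- exact: opnormD.
- have -> : map_mx ( *:%R a) u = a *: (u : 'M[C]_n.+1).
    by apply/matrixP => i j; rewrite !mxE.
  apply: le_anti; rewrite opnormZ_le/=.
  have [->|a0] := eqVneq a 0; first by rewrite normc0 mul0r opnorm_ge0.
  have na : 0 < normc a.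
    rewrite lt_neqAle normc_ge0 andbT eq_sym.
    by apply/eqP => /eq0_normc/eqP; rewrite (negPf a0).
  rewrite -ler_pdivlMl// -normcV.
  by rewrite -{1}(scale1r (u : 'M[C]_n.+1)) -(mulVf a0) -scalerA opnormZ_le.
- exact: opnorm_eq0.
- have split_l2 (x : 'cV[C]_n.+1) (y : 'cV[C]_m) :
    l2norm (col_mx x y) ^+ 2 = l2norm x ^+ 2 + l2norm y ^+ 2.
    rewrite !sqr_l2norm big_split_ord/=.
    congr (_ + _); apply: eq_bigr => i _; first by rewrite col_mxEu.
    by rewrite col_mxEd.
  have l2_0 (x : 'cV[C]_n.+1) : l2norm (col_mx x (0 : 'cV[C]_m)) = l2norm x.
    apply: (@pexpIrn _ 2) => //; rewrite ?nnegrE ?l2norm_ge0//.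
    by rewrite split_l2 l2norm0 expr0n/= addr0.
  have mulE (x : 'cV[C]_n.+1) (y : 'cV[C]_m) :
    (dsum0 m u : 'M[C]_(n.+1 + m)) *m col_mx x y = col_mx ((u : 'M[C]_n.+1) *m x) 0.
    by rewrite mul_block_col !mul0mx !addr0.
  apply: le_anti; apply/andP; split.
    apply: opnorm_le => x x1.
    rewrite -[x](@vsubmxK _ n.+1 m 1) [X in l2norm X <= _]mulE l2_0.
    apply: le_trans (l2norm_le_opnorm _ _) _; rewrite ler_piMr ?opnorm_ge0//.
    apply: le_trans x1; rewrite -[x in leRHS](@vsubmxK _ n.+1 m 1).
    rewrite -(@ler_pXn2r _ 2) ?nnegrE ?l2norm_ge0//.
    by rewrite [leRHS]split_l2 lerDl sqr_ge0.
  apply: opnorm_le => x x1.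
  rewrite -l2_0 -(mulE x 0).
  apply: le_trans (@l2norm_le_opnorm R (n + m).+1 _ _) _.
  by rewrite ler_piMr ?opnorm_ge0// [leLHS]l2_0.
- have -> : lact S u = S *m (u : 'M[C]_n.+1).
    by apply/matrixP => i j; rewrite !mxE.
  exact: opnormM.
- have -> : ract u S = (u : 'M[C]_n.+1) *m S.
    by apply/matrixP => i j; rewrite !mxE; apply: eq_bigr => l _; rewrite mulrC.
  exact: opnormM.
Qed.

Lemma has_sup_hat n (u : 'M['M[C]_k.+1]_n.+1) : has_sup (hat_values u).
Proof.
split.
  exists (mnorm (map_mx (phi (0 : 'M[MNSpace opnorm_matrix_norm]_k.+1)) u)).
  by exists (MNSpace opnorm_matrix_norm), 0; rewrite mnorm0.
exists (\sum_i \sum_j \sum_p \sum_q normc (u i j q p)) => _ [E [v [v1 ->]]].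
apply: le_trans (mnorm_le_sum _) _.
apply: ler_sum => i _; apply: ler_sum => j _; rewrite mxE.
have cst (x : 'I_k.+1 -> E) :
    const_mx (\sum_p x p) = \sum_p const_mx (x p) :> 'M[E]_1.
  by apply/matrixP => a b; rewrite summxE mxE; apply: eq_bigr => p _; rewrite mxE.
rewrite cst; apply: le_trans (mnorm_sum _ _ _) _; apply: ler_sum => p _.
rewrite cst; apply: le_trans (mnorm_sum _ _ _) _; apply: ler_sum => q _.
have -> : const_mx (u i j q p *: v p q) =
    map_mx ( *:%R (u i j q p)) (const_mx (v p q) : 'M[E]_1).
  by apply/matrixP => a b; rewrite !mxE.
by rewrite mnormZ ler_piMr ?normc_ge0// (le_trans (mnorm_entry p q v)).
Qed.

Lemma hat_norm_ub n (u : 'M['M[C]_k.+1]_n.+1) (E : mnSpace) (v : 'M[E]_k.+1) :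
  mnorm v <= 1 -> mnorm (map_mx (phi v) u) <= hat_norm u.
Proof.
move=> v1; apply: sup_upper_bound; first exact: has_sup_hat.
by exists E, v.
Qed.

Lemma hat_norm_le n (u : 'M['M[C]_k.+1]_n.+1) c :
  (forall (E : mnSpace) (v : 'M[E]_k.+1),
     mnorm v <= 1 -> mnorm (map_mx (phi v) u) <= c) -> hat_norm u <= c.
Proof.
move=> uc; apply: ge_sup; first by have [] := has_sup_hat u.
by move=> _ [E [v [v1 ->]]]; exact: uc.
Qed.

Lemma hat_norm_ge0 n (u : 'M['M[C]_k.+1]_n.+1) : 0 <= hat_norm u.
Proof.
apply: le_trans (@hat_norm_ub n u (MNSpace opnorm_matrix_norm) 0 _).
  exact: mnorm_ge0.
by rewrite mnorm0.
Qed.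

Lemma phi_lact (E : mnSpace) (v : 'M[E]_k.+1) n S (u : 'M['M[C]_k.+1]_n) :
  map_mx (phi v) (lact S u) = lact S (map_mx (phi v) u).
Proof.
apply/matrixP => i j; rewrite !mxE linear_sum; apply: eq_bigr => l _.
by rewrite linearZ/= !mxE.
Qed.

Lemma phi_ract (E : mnSpace) (v : 'M[E]_k.+1) n S (u : 'M['M[C]_k.+1]_n) :
  map_mx (phi v) (ract u S) = ract (map_mx (phi v) u) S.
Proof.
apply/matrixP => i j; rewrite !mxE linear_sum; apply: eq_bigr => l _.
by rewrite linearZ/= !mxE.
Qed.

Lemma phi_dsum0 (E : mnSpace) (v : 'M[E]_k.+1) n m (u : 'M['M[C]_k.+1]_n.+1) :
  map_mx (phi v) (dsum0 m u) = dsum0 m (map_mx (phi v) u).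
Proof. exact: map_dsum0. Qed.

Lemma hat_matrix_norm : is_matrix_norm hat_norm.
Proof.
have hatZ n a (u : 'M['M[C]_k.+1]_n.+1) :
    hat_norm (map_mx ( *:%R a) u) <= normc a * hat_norm u.
  apply: hat_norm_le => E v v1.
  have -> : map_mx (phi v) (map_mx ( *:%R a) u) =
      map_mx ( *:%R a) (map_mx (phi v) u).
    by apply/matrixP => i j; rewrite !mxE linearZ.
  by rewrite mnormZ ler_wpM2l ?normc_ge0// hat_norm_ub.
split => [n u w|n a u|n u u0|n m u|n S u|n S u].
- apply: hat_norm_le => E v v1; rewrite map_mxD.
  by apply: le_trans (mnormD _ _) _; rewrite lerD// hat_norm_ub.
- apply: le_anti; rewrite hatZ/=.
  have [->|a0] := eqVneq a 0; first by rewrite normc0 mul0r hat_norm_ge0.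
  have na : 0 < normc a.
    rewrite lt_neqAle normc_ge0 andbT eq_sym.
    by apply/eqP => /eq0_normc/eqP; rewrite (negPf a0).
  rewrite -ler_pdivlMl// -normcV.
  have {1}-> : u = map_mx ( *:%R a^-1) (map_mx ( *:%R a) u).
    by apply/matrixP => i j; rewrite !mxE scalerA mulVf// scale1r.
  exact: hatZ.
- apply/matrixP => i j; apply/matrixP => p q; rewrite !mxE.
  pose E := MNSpace opnorm_matrix_norm.
  pose v : 'M[E]_k.+1 := delta_mx q p.
  have v1 : mnorm v <= 1 by exact: opnorm_delta.
  have /mnorm_eq0/matrixP/(_ i j) : mnorm (map_mx (phi v) u) = 0.
    by apply: le_anti; rewrite mnorm_ge0 andbT -u0 hat_norm_ub.
  rewrite !mxE /phi (bigD1 q)//= [X in _ + X]big1 ?addr0 => [|q' qq]; last first.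
    by rewrite big1// => p' _; rewrite mxE (negPf qq) /= scaler0.
  rewrite (bigD1 p)//= [X in _ + X]big1 ?addr0 => [|p' pp].
    by rewrite mxE !eqxx/= [LHS]mulr1.
  by rewrite mxE (negPf pp) andbF scaler0.
- apply: le_anti; apply/andP; split; apply: hat_norm_le => E v v1.
    by rewrite phi_dsum0 mnorm_dsum0 hat_norm_ub.
  by rewrite -(mnorm_dsum0 m) -phi_dsum0 hat_norm_ub.
- apply: hat_norm_le => E v v1; rewrite phi_lact.
  by apply: le_trans (mnorm_lact _ _) _; rewrite ler_wpM2l ?opnorm_ge0// hat_norm_ub.
- apply: hat_norm_le => E v v1; rewrite phi_ract.
  by apply: le_trans (mnorm_ract _ _) _; rewrite ler_wpM2r ?opnorm_ge0// hat_norm_ub.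
Qed.

End Hat.

(* The space M_n^ for n = k.+1; the supremum defining its norm is finite and
   is over a nonempty set, by has_sup_hat. *)
Definition hatM k : mnSpace := MNSpace (hat_matrix_norm k).

Section DirectSum.
Variables (I : Type) (E : I -> lmodType C).

Record dsum := DSum {
  dsum_fun :> forall i, E i;
  dsum_finite : finite_set [set i | dsum_fun i != 0] }.

HB.instance Definition _ := gen_eqMixin dsum.
HB.instance Definition _ := gen_choiceMixin dsum.

Lemma dsum_eq (x y : dsum) : (forall i, x i = y i) -> x = y.
Proof.
case: x y => x fx [y fy] /= xy.
have {}xy : x = y by apply/functional_extensionality_dep.
by subst y; congr DSum; exact: Prop_irrelevance.
Qed.

Lemma dsum_zero_finite : finite_set [set i | (0 : E i) != 0].
Proof. by rewrite (_ : mkset _ = set0)// -subset0 => i /=; rewrite eqxx. Qed.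

Lemma dsum_add_finite (x y : dsum) : finite_set [set i | x i + y i != 0].
Proof.
apply: (@sub_finite_set _ _ ([set i | x i != 0] `|` [set i | y i != 0])).
  move=> i /= xy; have [x0|] := eqVneq (x i) 0; last by left.
  by right; move: xy; rewrite x0 add0r.
by rewrite finite_setU; split; exact: dsum_finite.
Qed.

Lemma dsum_opp_finite (x : dsum) : finite_set [set i | - x i != 0].
Proof.
by apply: sub_finite_set (dsum_finite x) => i /=; rewrite oppr_eq0.
Qed.

Lemma dsum_scale_finite a (x : dsum) : finite_set [set i | a *: x i != 0].
Proof.
apply: sub_finite_set (dsum_finite x) => i /=.
by apply: contra_neq => ->; rewrite scaler0.
Qed.

Definition dsum_zero := DSum dsum_zero_finite.
Definition dsum_add x y := DSum (dsum_add_finite x y).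
Definition dsum_opp x := DSum (dsum_opp_finite x).
Definition dsum_scale a x := DSum (dsum_scale_finite a x).

Lemma dsum_addA : associative dsum_add.
Proof. by move=> x y z; apply: dsum_eq => i /=; rewrite addrA. Qed.

Lemma dsum_addC : commutative dsum_add.
Proof. by move=> x y; apply: dsum_eq => i /=; rewrite addrC. Qed.

Lemma dsum_add0 : left_id dsum_zero dsum_add.
Proof. by move=> x; apply: dsum_eq => i /=; rewrite add0r. Qed.

Lemma dsum_addN : left_inverse dsum_zero dsum_opp dsum_add.
Proof. by move=> x; apply: dsum_eq => i /=; rewrite addNr. Qed.

HB.instance Definition _ :=
  GRing.isZmodule.Build dsum dsum_addA dsum_addC dsum_add0 dsum_addN.

Lemma dsum_scaleA a b x : dsum_scale a (dsum_scale b x) = dsum_scale (a * b) x.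
Proof. by apply: dsum_eq => i /=; rewrite scalerA. Qed.

Lemma dsum_scale1 : left_id 1 dsum_scale.
Proof. by move=> x; apply: dsum_eq => i /=; rewrite scale1r. Qed.

Lemma dsum_scaleDr : right_distributive dsum_scale +%R.
Proof. by move=> a x y; apply: dsum_eq => i /=; rewrite scalerDr. Qed.

Lemma dsum_scaleDl x : {morph dsum_scale^~ x : a b / a + b}.
Proof. by move=> a b; apply: dsum_eq => i /=; rewrite scalerDl. Qed.

HB.instance Definition _ := GRing.Zmodule_isLmodule.Build C dsum
  dsum_scaleA dsum_scale1 dsum_scaleDr dsum_scaleDl.

Definition dproj i (x : dsum) : E i := x i.

Lemma dproj_linear i : linear (dproj i).
Proof. by []. Qed.

HB.instance Definition _ i :=
  GRing.isLinear.Build C dsum (E i) _ (dproj i) (dproj_linear i).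

End DirectSum.

Section L1Sum.
Variables (I : Type) (E : I -> mnSpace).
Local Notation D := (@dsum I E).

(* The component of u in M_n(E_i). *)
Definition mxproj n (u : 'M[D]_n) i : 'M[E i]_n := map_mx (@dproj I E i) u.

(* All but finitely many components of u vanish, so that this sum over a
   finitely supported family is the full sum. *)
Definition l1norm n (u : 'M[D]_n.+1) : R :=
  \sum_(i \in [set: {classic I}]) mnorm (mxproj u i).

Lemma l1norm_support n (u : 'M[D]_n.+1) :
  finite_set [set i : {classic I} | mxproj u i <> 0].
Proof.
apply: (@sub_finite_set _ _ (\bigcup_(p in [set: 'I_n.+1 * 'I_n.+1])
    [set i : {classic I} | u p.1 p.2 i != 0])).
  move=> i /= ui; apply: contrapT => nui; apply: ui; apply/matrixP => a b.
  rewrite !mxE; apply/eqP/negPn/negP => uab.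
  by apply: nui; exists (a, b).
by apply: bigcup_finite => // p _; exact: dsum_finite.
Qed.

Lemma l1normE n (u : 'M[D]_n.+1) (A : set {classic I}) : finite_set A ->
  [set i : {classic I} | mxproj u i <> 0] `<=` A ->
  l1norm u = \sum_(i <- fset_set A) mnorm (mxproj u i).
Proof.
move=> fA uA; rewrite -fsbig_finite// /l1norm; apply/esym/fsbig_widen => //.
move=> i [_ nA] /=; suff -> : mxproj u i = 0 by rewrite mnorm0.
by apply: contrapT => /uA.
Qed.

Lemma l1_matrix_norm : is_matrix_norm l1norm.
Proof.
have supp n (u : 'M[D]_n.+1) := l1norm_support u.
split => [n u w|n a u|n u u0|n m u|n S u|n S u].
- pose A := [set i : {classic I} | mxproj u i <> 0] `|`
            [set i : {classic I} | mxproj w i <> 0].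
  have fA : finite_set A by rewrite finite_setU.
  have projD i : mxproj (u + w) i = mxproj u i + mxproj w i by exact: map_mxD.
  rewrite (@l1normE _ u A)//; last by move=> i; left.
  rewrite (@l1normE _ w A)//; last by move=> i; right.
  rewrite (@l1normE _ (u + w) A)//; last first.
    move=> i /=; rewrite projD => uw.
    by have [u0|] := pselect (mxproj u i = 0); [right => w0; rewrite u0 w0 addr0 in uw|left].
  by rewrite -big_split/=; apply: ler_sum => i _; rewrite projD mnormD.
- have projZ i : mxproj (map_mx ( *:%R a) u) i = map_mx ( *:%R a) (mxproj u i).
    by apply/matrixP => p q; rewrite !mxE.
  rewrite (@l1normE _ u _ (supp n u))// (l1normE (supp n u))//; last first.
    move=> i /=; apply: contra_not => ui; rewrite projZ ui.
    by apply/matrixP => p q; rewrite !mxE scaler0.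
  by rewrite mulr_sumr; apply: eq_bigr => i _; rewrite projZ mnormZ.
- apply/matrixP => p q; rewrite mxE; apply: dsum_eq => i.
  suff /matrixP/(_ p q) : mxproj u i = 0 by rewrite !mxE.
  apply: contrapT => ui; move: u0; rewrite (l1normE (supp n u))//.
  move/eqP; rewrite psumr_eq0 => [|j _]; last exact: mnorm_ge0.
  move/allP/(_ i); rewrite in_fset_set// => /(_ (mem_set ui))/eqP/mnorm_eq0.
  exact: ui.
- have projd i : mxproj (dsum0 m u) i = dsum0 m (mxproj u i).
    exact: map_dsum0.
  rewrite (@l1normE _ u _ (supp n u))// (l1normE (supp n u))//; last first.
    move=> i /=; apply: contra_not => ui; apply: mnorm_eq0.
    by rewrite projd mnorm_dsum0 ui mnorm0.
  by apply: eq_bigr => i _; rewrite projd mnorm_dsum0.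
- have projl i : mxproj (lact S u) i = lact S (mxproj u i).
    apply/matrixP => p q; rewrite !mxE linear_sum; apply: eq_bigr => l _.
    by rewrite linearZ/= !mxE.
  rewrite (@l1normE _ u _ (supp n u))// (l1normE (supp n u))//; last first.
    move=> i /=; apply: contra_not => ui; rewrite projl ui.
    by apply/matrixP => p q; rewrite !mxE big1// => l _; rewrite mxE scaler0.
  by rewrite mulr_sumr; apply: ler_sum => i _; rewrite projl mnorm_lact.
- have projr i : mxproj (ract u S) i = ract (mxproj u i) S.
    apply/matrixP => p q; rewrite !mxE linear_sum; apply: eq_bigr => l _.
    by rewrite linearZ/= !mxE.
  rewrite (@l1normE _ u _ (supp n u))// (l1normE (supp n u))//; last first.
    move=> i /=; apply: contra_not => ui; rewrite projr ui.
    by apply/matrixP => p q; rewrite !mxE big1// => l _; rewrite mxE scaler0.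
  by rewrite mulr_suml; apply: ler_sum => i _; rewrite projr mnorm_ract.
Qed.

Definition l1sum : mnSpace := MNSpace l1_matrix_norm.

End L1Sum.

(* The index k : nat stands for the size k.+1 >= 1. *)
Definition hatMoo : mnSpace := l1sum hatM.

End MatriciallyNormed.

Arguments mnorm {R _ n}.

(* Main.v *)
(** The space [l1sum E] is the coproduct of the family [E] in [MN1], and
    [hatM k] represents the functor taking [X] to the unit ball of
    [M_{k+1}(X)]: the universal element is the matrix of matrix units
    [e_{ji}], which [phi v] maps to [v].  A map from [M] to the product of the
    unit balls of [X] is thus a doubly indexed family of morphisms
    [hatM k -> X], that is, a morphism from the iterated coproduct. *)
Require Import Defs.
From HB Require Import structures.
From mathcomp Require Import all_boot all_order all_algebra.
From mathcomp Require Import all_classical all_reals.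
From mathcomp Require Import finmap complex.

Set Implicit Arguments.
Unset Strict Implicit.
Unset Printing Implicit Defensive.

Import Order.TTheory GRing.Theory Num.Theory.

Local Open Scope classical_set_scope.
Local Open Scope ring_scope.

HB.instance Definition _ (R : realType) (E F : mnSpace R) (f : mnHom E F) :=
  GRing.isLinear.Build R[i] E F _ (mn_fun f) (mn_linear f).

Section Coproduct.
Variables (R : realType) (I : Type) (E : I -> mnSpace R).
Local Notation D := (@dsum R I E).
Local Notation supp x := [set i : {classic I} | (x : D) i != 0].

(** [I] is an arbitrary type; [{classic I}] gives it the classical decidable equality with which
    [dfwith] overwrites the zero family at [i]. *)
Definition dsum_inj_fun (i : I) (x : E i) : forall j : {classic I}, E j :=
  @eqtype.dfwith {classic I} E (fun=> 0) i x.

Lemma dsum_inj_finite (i : I) (x : E i) :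
  finite_set [set j | dsum_inj_fun x j != 0].
Proof.
apply: (@sub_finite_set {classic I} _ [set (i : {classic I})]) => // j /=.
rewrite /dsum_inj_fun; have [->//|ij] := eqVneq j (i : {classic I}).
by rewrite dfwith_out ?eqxx// eq_sym.
Qed.

Definition dsum_inj (i : I) (x : E i) : D := DSum (dsum_inj_finite x).

Lemma dsum_inj_in (i : I) (x : E i) : dsum_inj x i = x.
Proof. exact: (@dfwith_in {classic I} E (fun=> 0)). Qed.

Lemma dsum_inj_out (i j : {classic I}) (x : E i) : i != j -> dsum_inj x j = 0.
Proof. exact: dfwith_out. Qed.

Lemma dsum_inj_linear (i : I) : linear (@dsum_inj i : E i -> D).
Proof.
move=> a x y; apply: dsum_eq => j; change (dsum_inj (a *: x + y) j =
  a *: dsum_inj x j + dsum_inj y j).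
have [<-|ij] := eqVneq (i : {classic I}) j; first by rewrite !dsum_inj_in.
by rewrite !dsum_inj_out// scaler0 addr0.
Qed.

(** The $\ell_1$-sum collapses to its single possibly nonzero term, the one at [i], so the embedding
    is even isometric. *)
Lemma dsum_inj_cc (i : I) :
  @completely_contractive R (E i) (l1sum E) (@dsum_inj i).
Proof.
move=> n u; have ui : mxproj (map_mx (@dsum_inj i) u) i = u.
  by apply/matrixP => p q; rewrite !mxE; exact: dsum_inj_in.
have uj (j : {classic I}) : (i : {classic I}) != j ->
    mxproj (map_mx (@dsum_inj i) u) j = 0.
  by move=> ij; apply/matrixP => p q; rewrite !mxE; exact: dsum_inj_out.
rewrite [leLHS](@l1normE R I E n _ [set (i : {classic I})])//.
  by rewrite fset_set1 big_seq_fset1 ui.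
by move=> j /=; apply: contra_notP => /eqP; rewrite eq_sym => /uj.
Qed.

Definition l1inj (i : I) : mnHom (E i) (l1sum E) :=
  @MNHom R (E i) (l1sum E) _ (@dsum_inj_linear i) (@dsum_inj_cc i).

Lemma dsum_sum_inj (x : D) :
  x = \sum_(i <- fset_set (supp x)) dsum_inj (x i).
Proof.
apply: dsum_eq => j; rewrite -[RHS]/(dproj j _) linear_sum/=.
have [xj|xj] := boolP ((j : {classic I}) \in fset_set (supp x)).
  rewrite (big_fsetD1 (j : {classic I}))//= [X in _ + X]big1_fset ?addr0.
    exact: esym (dsum_inj_in _).
  by move=> i; rewrite !inE => /andP[ij _] _; exact: dsum_inj_out.
rewrite big1_fset => [|i ix _].
  apply/eqP; move: xj; rewrite in_fset_set; last exact: dsum_finite.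
  by apply: contraNT => ?; exact/mem_set.
by apply: dsum_inj_out; apply: contraNneq xj => <-.
Qed.

(** Uniqueness half of the coproduct property. Elements are finite sums of embedded ones, no
    completion being taken, so linearity alone suffices. *)
Lemma l1hom_eq (X : mnSpace R) (f g : mnHom (l1sum E) X) :
  (forall i (x : E i), f (l1inj i x) = g (l1inj i x)) -> f = g.
Proof.
move=> fg; apply: mnHom_eq => x; rewrite (dsum_sum_inj x) !linear_sum.
by apply: eq_bigr => i _; exact: fg.
Qed.

Variables (X : mnSpace R) (f : forall i, mnHom (E i) X).

Definition copair (x : D) : X := \sum_(i \in [set: {classic I}]) f i (x i).

(** Allows sums for vectors with different supports to be compared over one common finite index
    set. *)
Lemma copairE (x : D) (A : set {classic I}) : finite_set A -> supp x `<=` A ->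
  copair x = \sum_(i <- fset_set A) f i (x i).
Proof.
move=> fA xA; rewrite -fsbig_finite// /copair; apply/esym/fsbig_widen => //.
move=> i [_ nA] /=; suff -> : x i = 0 by rewrite linear0.
by apply/eqP/negPn/negP => /xA.
Qed.

Lemma copair_linear : linear (copair : D -> X).
Proof.
move=> a x y; pose A := supp x `|` supp y.
have fA : finite_set A by rewrite finite_setU; split; exact: dsum_finite.
rewrite (@copairE x A)//; last by move=> i; left.
rewrite (@copairE y A)//; last by move=> i; right.
rewrite (@copairE _ A)//; last first.
  move=> i /=; have [x0|] := eqVneq (x i) 0; last by left.
  by rewrite x0 scaler0 add0r; right.
rewrite scaler_sumr -big_split/=; apply: eq_bigr => i _.
by rewrite linearP.
Qed.

(** The triangle inequality bounds the image by the sum of the norms of its components, which is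
    what the $\ell_1$-norm controls. *)
Lemma copair_cc : @completely_contractive R (l1sum E) X copair.
Proof.
move=> n u; have fA := l1norm_support u.
rewrite [leRHS](l1normE fA)//.
have -> : map_mx copair u = \sum_(i <- fset_set
    [set i : {classic I} | mxproj u i <> 0]) map_mx (f i) (mxproj u i).
  apply/matrixP => p q; rewrite summxE mxE (copairE fA).
    by apply: eq_bigr => i _; rewrite !mxE.
  (* The support of each entry of [u] lies in the set of indices of nonzero components of [u]. *)
  move=> i /= /eqP upq ui; apply: upq.
  by move/matrixP/(_ p q): ui; rewrite !mxE.
by apply: le_trans (mnorm_sum _ _ _) _; apply: ler_sum => i _; exact: mn_cc.
Qed.

Definition l1copair : mnHom (l1sum E) X :=
  @MNHom R (l1sum E) X _ copair_linear copair_cc.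

Lemma l1copair_inj i (x : E i) : l1copair (l1inj i x) = f i x.
Proof.
rewrite /= (@copairE _ [set (i : {classic I})])//.
  by rewrite fset_set1 big_seq_fset1; congr (f i _); exact: dsum_inj_in.
by move=> j /=; apply: contra_neqP => /eqP ij; apply: dsum_inj_out; rewrite eq_sym.
Qed.

End Coproduct.

Section HatUniversal.
Variables (R : realType) (k : nat).

Definition hat_gen : 'M[hatM R k]_k.+1 := \matrix_(i, j) delta_mx j i.

Lemma phi_hat_gen (X : mnSpace R) (v : 'M[X]_k.+1) :
  map_mx (phi v) hat_gen = v.
Proof.
apply/matrixP => i j; rewrite !mxE /phi (bigD1 i)//= [X in _ + X]big1.
  rewrite addr0 (bigD1 j)//= [X in _ + X]big1 ?addr0 => [|l lj].
    by rewrite mxE !eqxx scale1r.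
  by rewrite mxE (negPf lj) scale0r.
by move=> l li; rewrite big1// => m _; rewrite mxE (negPf li) andbF scale0r.
Qed.

(** Every competitor in the supremum defining the norm is the norm of some [v] in a unit ball. *)
Lemma hat_gen_le1 : mnorm hat_gen <= 1.
Proof. by apply: hat_norm_le => X v v1; rewrite phi_hat_gen. Qed.

Definition hat_gen_ball : mxball (hatM R k) k := exist _ hat_gen hat_gen_le1.

Variable X : mnSpace R.

(** The pair of [X] and [w] is itself a competitor in that supremum. *)
Lemma phi_cc (w : mxball X k) :
  @completely_contractive R (hatM R k) X (phi (sval w)).
Proof. by move=> n u; apply: hat_norm_ub; exact: (svalP w). Qed.

Definition hat_hom (w : mxball X k) : mnHom (hatM R k) X :=
  @MNHom R (hatM R k) X _ (phi_linear (sval w)) (@phi_cc w).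

Lemma hat_hom_gen (w : mxball X k) : mxball_map (hat_hom w) hat_gen_ball = w.
Proof. by apply/val_inj; exact: phi_hat_gen. Qed.

(** A linear map on matrices is determined by its values on the matrix units, and these are the
    entries of the image of [hat_gen]. *)
Lemma hat_hom_mxball_map (T : mnHom (hatM R k) X) :
  hat_hom (mxball_map T hat_gen_ball) = T.
Proof.
apply: mnHom_eq => l; rewrite [in RHS](matrix_sum_delta l) linear_sum /= /phi.
(* Swapping the sums absorbs the transposition in [phi]. *)
rewrite exchange_big/=; apply: eq_bigr => i _.
rewrite linear_sum; apply: eq_bigr => j _.
by rewrite !mxE [RHS]linearZ.
Qed.

End HatUniversal.

Theorem theorem4 (R : realType) :
  (forall M : Type,
     @is_free (MN1 R) SET (odot R) M (l1sum (fun _ : M => hatMoo R))) /\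
  admits_freeness (odot R).
Proof.
suff free (M : Type) :
    @is_free (MN1 R) SET (odot R) M (l1sum (fun _ : M => hatMoo R)).
  by split=> // M; exists (l1sum (fun _ : M => hatMoo R)).
pose F := l1sum (fun _ : M => hatMoo R).
pose inj m k : mnHom (hatM R k) F :=
  mn_comp (l1inj (fun _ : M => hatMoo R) m) (l1inj (hatM R) k).
pose beta (X : mnSpace R) (f : M -> odot_obj X) : mnHom F X :=
  l1copair (fun m => l1copair (fun k => hat_hom (f m k))).
have beta_inj X f m k : mn_comp (beta X f) (inj m k) = hat_hom (f m k).
  by apply: mnHom_eq => l; rewrite /beta/= [LHS]l1copair_inj [LHS]l1copair_inj.
(* Uniqueness for the iterated coproduct: [l1hom_eq] is applied first over the points of [M], then
   over the matrix sizes. *)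
have homF_eq X (S T : mnHom F X) :
    (forall m k, mn_comp S (inj m k) = mn_comp T (inj m k)) -> S = T.
  move=> ST; apply: l1hom_eq => m.
  pose h (U : mnHom F X) := mn_comp U (l1inj (fun _ : M => hatMoo R) m).
  suff : h S = h T by move=> /(congr1 (@mn_fun _ _ _)) + x => /(congr1 (@^~ x)).
  apply: l1hom_eq => k l; have := congr1 (@mn_fun _ _ _) (ST m k).
  by move=> /(congr1 (@^~ l)).
(* The inverse of [beta X] evaluates a morphism at the universal elements of all the copies of
   [hatM R k]. *)
pose gen (X : mnSpace R) (T : mnHom F X) (m : M) k :=
  mxball_map (mn_comp T (inj m k)) (hat_gen_ball R k).
exists beta; split=> [X|X Y h f].
  exists (gen X) => [f|T].
    apply/funext => m; apply/functional_extensionality_dep => k.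
    by rewrite /gen beta_inj hat_hom_gen.
  by apply: homF_eq => m k; rewrite beta_inj hat_hom_mxball_map.
(* Naturality, tested on each copy of [hatM R k], reduces to [h] commuting with the linear
   combination [phi]. *)
apply: homF_eq => m k; rewrite beta_inj; apply: mnHom_eq => l.
rewrite -mn_compA beta_inj/= linear_sum.
by apply: eq_bigr => i _; rewrite linear_sum; apply: eq_bigr => j _; rewrite mxE linearZ.
Qed.
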